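(* Let $\Theta$ be a $3\times 3$ phase matrix. Then $\operatorname{rank}_{\text{phase}}(\Theta) < 3$ if and only if the origin is in the relative interior of the convex hull of (the set of entries of) $\overrightarrow{\det(\Theta)}$.
   Context: Let $S^1=\{z\in\mathbb{C}:|z|=1\}$ and $\mathbb{C}^*=\mathbb{C}\setminus\{0\}$. A phase matrix is a matrix with all entries in $S^1$. For an $n\times m$ phase matrix $\Theta$, its phase rank is $$\operatorname{rank}_{\text{phase}}(\Theta)=\min\{\operatorname{rank}(M): M\in(\mathbb{C}^* )^{n\times m},\ \tfrac{M_{ij}}{|M_{ij}|}=\Theta_{ij}\ \text{for all } i,j\},$$ where $\operatorname{rank}$ is the usual rank over $\mathbb{C}$. For a $3\times 3$ phase matrix $\Theta$, $\overrightarrow{\det(\Theta)}\in\mathbb{C}^6$ denotes the vector of signed monomials of the $3\times 3$ determinant evaluated at $\Theta$: $$\overrightarrow{\det(\Theta)}=(\Theta_{11}\Theta_{22}\Theta_{33},\ \Theta_{12}\Theta_{23}\Theta_{31},\ \Theta_{13}\Theta_{21}\Theta_{32},\ -\Theta_{11}\Theta_{23}\Theta_{32},\ -\Theta_{12}\Theta_{21}\Theta_{33},\ -\Theta_{13}\Theta_{22}\Theta_{31}).$$ Its six entries are regarded as points of $\mathbb{R}^2\cong\mathbb{C}$ when taking the convex hull; relative interior means interior relative to the affine hull. *)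

(* Defs.v *)
From HB Require Import structures.
From mathcomp Require Import all_boot all_order all_algebra.
From mathcomp Require Import complex.
From mathcomp Require Import boolp classical_sets reals topology normedtype convex.

Set Implicit Arguments.
Unset Strict Implicit.
Unset Printing Implicit Defensive.

Import Order.TTheory GRing.Theory Num.Theory.
Import numFieldNormedType.Exports.

Local Open Scope classical_set_scope.
Local Open Scope ring_scope.

Section PhaseRank.
Variables (R : realType) (n m : nat).
Implicit Types Theta M : 'M[R[i]]_(n, m).

Definition is_phase_mx Theta : Prop := forall i j, `|Theta i j| = 1.

Definition has_phase Theta M : Prop :=
  forall i j, M i j != 0 /\ M i j / `|M i j| = Theta i j.

Definition phase_rank_values Theta : pred nat :=
  fun r => `[< exists2 M, has_phase Theta M & \rank M = r >].

Lemma phase_rank_values_ex Theta :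
  is_phase_mx Theta -> exists r, phase_rank_values Theta r.
Proof.
move=> hTheta; exists (\rank Theta); apply/asboolP; exists Theta => // i j.
by rewrite -normr_eq0 hTheta oner_eq0 divr1.
Qed.

(* Only defined on phase matrices, for which the minimum is over a nonempty
   set; its value does not depend on the proof [hTheta]. *)
Definition phase_rank Theta (hTheta : is_phase_mx Theta) : nat :=
  ex_minn (phase_rank_values_ex hTheta).

End PhaseRank.

Definition det_vector (R : realType) (Theta : 'M[R[i]]_3) : 6.-tuple R[i] :=
  [tuple   Theta 0 0 * Theta 1 1 * Theta 2 2;
           Theta 0 1 * Theta 1 2 * Theta 2 0;
           Theta 0 2 * Theta 1 0 * Theta 2 1;
         - (Theta 0 0 * Theta 1 2 * Theta 2 1);
         - (Theta 0 1 * Theta 1 0 * Theta 2 2);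
         - (Theta 0 2 * Theta 1 1 * Theta 2 0)].

Section Hulls.
Variables (R : realType) (V : normedModType R).
Implicit Types A : set V.

Definition convex_hull A : set V := smallest (@convex_set R V) A.

Definition affine_set A : Prop :=
  forall (x y : V) (t : R), A x -> A y -> A (t *: x + (1 - t) *: y).

Definition affine_hull A : set V := smallest affine_set A.

Definition relative_interior A : set V :=
  [set x | A x /\ \forall y \near x, affine_hull A y -> A y].

End Hulls.

(* R^o * R^o carries the max norm, hence the usual topology of the plane. *)
Definition complex_to_plane (R : realType) (z : R[i]) : R^o * R^o :=
  (complex.Re z, complex.Im z).

(* Main.v *)
(* Positive rescalings [A o Theta] have determinant [sum_s a_s v_s], where [v] is
   [det_vector Theta] and [a_s] is the product of the entries of [A] along the
   permutation [s]; such an [a] is any positive vector whose products over the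
   even and over the odd permutations agree.  On the other hand, 0 lies in the
   relative interior of the hull of [v] iff [sum_s l_s v_s = 0] for some [l > 0].
   To balance the two products of [l], say when the even one is the larger: the
   three even [v_s] lie in a plane, hence are linearly dependent, and moving [l]
   along a dependency changes only the even weights and makes one of them vanish
   eventually, so by continuity the even product reaches the odd one on the way. *)
Require Import Defs.
From mathcomp Require Import all_boot all_order all_algebra.
From mathcomp Require Import complex.
From mathcomp Require Import boolp classical_sets reals topology normedtype convex.
From mathcomp Require Import interval_inference prodnormedzmodule ring lra.

Set Implicit Arguments.
Unset Strict Implicit.
Unset Printing Implicit Defensive.

Import Order.TTheory GRing.Theory Num.Theory.
Import numFieldNormedType.Exports.

Local Open Scope classical_set_scope.
Local Open Scope ring_scope.

(** * Hulls of a finite family and the relative interior of a hull *)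

Lemma convex_setP (R : numDomainType) (V : lmodType R) (A : set V) :
  convex_set A <-> forall (x y : V) (t : R),
    0 <= t -> t <= 1 -> A x -> A y -> A (t *: x + (1 - t) *: y).
Proof.
split=> [cA x y t t0 t1 Ax Ay | cA x y t /set_mem Ax /set_mem Ay].
  by have /set_mem := cA x y (Itv01 t0 t1) (mem_set Ax) (mem_set Ay).
by apply/mem_set; apply: cA.
Qed.

Section ConvexCombinations.
Variables (R : realFieldType) (V : lmodType R) (I : finType).

(* Inducting on the normalized partial sums avoids reindexing the family. *)
Lemma convex_set_sum (A : set V) (w : I -> R) (x : I -> V) :
  convex_set A -> (forall i, 0 <= w i) -> \sum_i w i = 1 ->
  (forall i, A (x i)) -> A (\sum_i w i *: x i).
Proof.
move=> /convex_setP cA w0 w1 Ax.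
pose K (a : R) (u : V) := (a = 0 /\ u = 0) \/ (0 < a /\ A (a^-1 *: u)).
suff: K (\sum_i w i) (\sum_i w i *: x i).
  rewrite w1; case=> [[/eqP]|[_]]; first by rewrite oner_eq0.
  by rewrite invr1 scale1r.
apply: (big_ind2 K) => [|a u b v|i _]; first by left.
- case=> [[-> ->]|[a0 Au]]; first by rewrite !add0r.
  case=> [[-> ->]|[b0 Av]]; first by rewrite !addr0; right.
  right; have ab0 : 0 < a + b by apply: addr_gt0.
  split=> //.
  have -> : (a + b)^-1 *: (u + v) =
      (a / (a + b)) *: (a^-1 *: u) + (1 - a / (a + b)) *: (b^-1 *: v).
    rewrite !scalerA scalerDr; congr (_ *: _ + _ *: _); field.
      by rewrite !gt_eqF.
    by rewrite !gt_eqF.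
  apply: cA => //; first by rewrite divr_ge0 // ltW.
  by rewrite ler_pdivrMr // mul1r lerDl ltW.
- have [wi|wi] := eqVneq (w i) 0; first by left; rewrite wi scale0r.
  right; have wi0 : 0 < w i by rewrite lt_neqAle eq_sym wi w0.
  by rewrite scalerA mulVf // scale1r.
Qed.

End ConvexCombinations.

Section Hulls.
Variables (R : realType) (V : normedModType R) (I : finType) (v : I -> V).

Lemma convex_hull_range :
  convex_hull (range v) = [set y | exists w : I -> R,
    [/\ forall i, 0 <= w i, \sum_i w i = 1 & y = \sum_i w i *: v i]].
Proof.
apply/seteqP; split=> [|y [w [w0 w1 ->]]].
  apply: smallest_sub => [|_ [i _ <-]].
    apply/convex_setP => x y t t0 t1 [a [a0 a1 ->]] [b [b0 b1 ->]].
    exists (fun i => t * a i + (1 - t) * b i); split=> [i||].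
    - by rewrite addr_ge0 // mulr_ge0 // subr_ge0.
    - by rewrite big_split /= -!mulr_sumr a1 b1 !mulr1 addrC subrK.
    - rewrite !scaler_sumr -big_split /=; apply: eq_bigr => i _.
      by rewrite !scalerA -scalerDl.
  exists (fun j => (j == i)%:R); split=> [j||]; first by rewrite ler0n.
  - by rewrite (bigD1 i) //= eqxx big1 ?addr0 // => j /negPf ->.
  - rewrite (bigD1 i) //= eqxx scale1r big1 ?addr0 // => j /negPf ->.
    by rewrite scale0r.
move=> B [cB vB]; apply: convex_set_sum => // i.
by apply: vB; exists i.
Qed.

(** An affine set through 0 is a linear subspace: the line through 0 and [x] gives the multiples of
    [x], and a sum is twice a midpoint. *)
Lemma affine_set_sum0 (A : set V) (c : I -> R) :
  affine_set A -> A 0 -> (forall i, A (v i)) -> A (\sum_i c i *: v i).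
Proof.
move=> aA A0 Av; apply: big_ind => // [x y Ax Ay|i _].
  have {}aA2 : forall z, A z -> A (2 *: z).
    by move=> z Az; have := aA z 0 2 Az A0; rewrite scaler0 addr0.
  have := aA2 _ (aA x y 2^-1 Ax Ay).
  rewrite scalerDr !scalerA; congr A; rewrite -[in RHS](scale1r x) -[in RHS](scale1r y).
  by congr (_ *: _ + _ *: _); field.
by have := aA (v i) 0 (c i) (Av i) A0; rewrite scaler0 addr0.
Qed.

Lemma affine_hull_span (A : set V) :
  (forall x, A x -> exists c : I -> R, x = \sum_i c i *: v i) ->
  forall x, affine_hull A x -> exists c : I -> R, x = \sum_i c i *: v i.
Proof.
move=> AS; apply: smallest_sub => // x y t [a ->] [b ->].
exists (fun i => t * a i + (1 - t) * b i).
rewrite !scaler_sumr -big_split /=; apply: eq_bigr => i _.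
by rewrite !scalerA -scalerDl.
Qed.

(** A small negative multiple [- (d *: s)] of the sum of all generators still lies in the hull.
    Adding [d] to each of its nonnegative convex weights yields a strictly positive relation. *)
Lemma relint0_positive_relation :
  relative_interior (convex_hull (range v)) 0 ->
  exists2 l : I -> R, forall i, 0 < l i & \sum_i l i *: v i = 0.
Proof.
case=> C0 /nbhs_normP [e /= e0 eC].
set s := \sum_i v i.
(* Small enough for [d *: s] to have norm below [e]; the [+ 1] covers [s = 0]. *)
pose d := e / (2 * (`|s| + 1)).
have s1 : 0 < `|s| + 1 by rewrite ltr_wpDl.
have d0 : 0 < d by rewrite divr_gt0 // mulr_gt0.
have: convex_hull (range v) (- (d *: s)).
  apply: eC => /=.
    rewrite sub0r opprK normrZ gtr0_norm // /d.
    rewrite mulrAC ltr_pdivrMr ?mulr_gt0 // ltr_pM2l //.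
    have := normr_ge0 s; lra.
  rewrite /s -scaleNr scaler_sumr => B [aB CB].
  apply: (affine_set_sum0 (fun=> - d)) => //; first exact: CB.
  by move=> i; apply: CB => D [cD]; apply; exists i.
rewrite convex_hull_range => -[w [w0 _ E]].
exists (fun i => w i + d) => [i|]; first by rewrite ltr_wpDl.
under eq_bigr do rewrite scalerDl.
by rewrite big_split /= -scaler_sumr -E addNr.
Qed.

(** By the first hypothesis, a point of the span near 0 has small coefficients. Adding them to half
    of the normalized relation keeps all weights nonnegative and their total at most 1. The index
    [i0] witnesses that the family is nonempty. *)
Lemma relint0_of_positive_relation (i0 : I) (l : I -> R) (C : R) :
  (forall c : I -> R, exists2 c' : I -> R,
     \sum_i c i *: v i = \sum_i c' i *: v i &
     forall i, `|c' i| <= C * `|\sum_i c i *: v i|) ->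
  (forall i, 0 < l i) -> \sum_i l i *: v i = 0 ->
  relative_interior (convex_hull (range v)) 0.
Proof.
move=> HC l0 lv.
pose L := \sum_i l i.
have L0 : 0 < L.
  by rewrite /L (bigD1 i0) //= ltr_pwDl // sumr_ge0 // => i _; apply: ltW.
pose w i := l i / L.
have w0 i : 0 < w i by rewrite divr_gt0.
have w1 : \sum_i w i = 1 by rewrite -mulr_suml divff // gt_eqF.
have wv : \sum_i w i *: v i = 0.
  under eq_bigr do rewrite /w mulrC -scalerA.
  by rewrite -scaler_sumr lv scaler0.
(* The missing mass is spread along [w], which represents 0 and so does not move the point. *)
have hull0 (m : I -> R) : (forall i, 0 <= m i) -> \sum_i m i <= 1 ->
    convex_hull (range v) (\sum_i m i *: v i).
  move=> m0 m1; rewrite convex_hull_range.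
  exists (fun i => m i + (1 - \sum_i m i) * w i); split.
  - by move=> i; rewrite addr_ge0 // mulr_ge0 ?subr_ge0 // ltW.
  - by rewrite big_split /= -mulr_sumr w1 mulr1 addrC subrK.
  - under [RHS]eq_bigr do rewrite scalerDl -scalerA.
    by rewrite big_split /= -scaler_sumr wv scaler0 addr0.
split.
  have zv : \sum_i (fun=> 0 : R) i *: v i = 0.
    by apply: big1 => i _; rewrite scale0r.
  by rewrite -zv; apply: hull0; rewrite // big1.
pose q := \big[Num.min/1]_i w i.
have q0 : 0 < q by apply/bigmin_gtP; split.
have qw i : q <= w i by apply: bigmin_le.
pose N := (#|I|%:R : R).
have N0 : 0 <= N by rewrite ler0n.
have CC : C <= `|C| by apply: ler_norm.
(* The factor [|C| + 1] absorbs the bound on the coefficients. The factor [N + 1] makes even their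
   sum at most [q / 2]. *)
pose e := (q / 2) / ((`|C| + 1) * (N + 1)).
have D0 : 0 < (`|C| + 1) * (N + 1).
  by rewrite mulr_gt0 // ltr_wpDl.
have e0 : 0 < e by rewrite divr_gt0 // divr_gt0.
apply/nbhs_normP; exists e => // y /=; rewrite sub0r normrN => ye yA.
have [c yc] : exists c : I -> R, y = \sum_i c i *: v i.
  apply: affine_hull_span yA => x; rewrite convex_hull_range.
  by case=> w' [_ _ ->]; exists w'.
have [c' cc' c'C] := HC c.
rewrite -yc in cc' c'C.
have c'q i : `|c' i| * (N + 1) <= q / 2.
  have : `|c' i| <= (`|C| + 1) * e.
    apply: (le_trans (c'C i)).
    apply: (@le_trans _ _ ((`|C| + 1) * `|y|)).
      by rewrite ler_wpM2r //; lra.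
    by rewrite ler_wpM2l ?ltW // ltr_wpDl.
  move=> h; rewrite -ler_pdivlMr ?ltr_wpDl //.
  apply: (le_trans h); rewrite /e le_eqVlt; apply/orP; left; apply/eqP.
  by field; rewrite !gt_eqF // ltr_wpDl.
have c'q1 i : `|c' i| <= q / 2.
  apply: le_trans (c'q i); rewrite ler_peMr //; lra.
(* Halving [w] leaves room on both sides: each weight is at least [q / 2 - q / 2], and the total is
   at most [1 / 2 + q / 2]. *)
have -> : y = \sum_i (w i / 2 + c' i) *: v i.
  under eq_bigr do rewrite scalerDl mulrC -scalerA.
  by rewrite big_split /= -scaler_sumr wv scaler0 add0r.
apply: hull0 => [i|].
  have := c'q1 i; have := qw i; rewrite ler_norml => ? /andP[]; lra.
rewrite big_split /= -mulr_suml w1.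
have S : \sum_i c' i <= \sum_(i : I) (q / 2) / (N + 1).
  apply: ler_sum => i _; apply: (le_trans (ler_norm _)).
  by rewrite ler_pdivlMr ?ltr_wpDl.
have q1 : q <= 1.
  apply: (le_trans (qw i0)); rewrite -w1 (bigD1 i0) //= lerDl sumr_ge0 //.
  by move=> i _; apply: ltW.
have : \sum_(i : I) (q / 2) / (N + 1) <= q / 2.
  rewrite sumr_const -[_ *+ _]mulr_natr mulrAC ler_pdivrMr ?ltr_wpDl //.
  by rewrite ler_pM2l ?lerDl ?divr_gt0.
lra.
Qed.

End Hulls.

(** * Bounded coordinates for vectors of the plane *)

(** Coordinates can be chosen linear in the vector, hence bounded by its norm. Cases on the
    dimension of the span: Cramer's rule for two independent members, orthogonal projection onto one
    nonzero member, or all members zero. *)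
Lemma plane_bounded_coords (R : realType) (I : finType)
    (v : I -> R^o * R^o) :
  exists C : R, forall c : I -> R, exists2 c' : I -> R,
    \sum_i c i *: v i = \sum_i c' i *: v i &
    forall i, `|c' i| <= C * `|\sum_i c i *: v i|.
Proof.
pose det2 (x y : R^o * R^o) : R := x.1 * y.2 - x.2 * y.1.
have sum1 (c : I -> R) : (\sum_i c i *: v i).1 = \sum_i c i * (v i).1.
  by rewrite (big_morph fst (id1 := 0) (op1 := +%R)).
have sum2 (c : I -> R) : (\sum_i c i *: v i).2 = \sum_i c i * (v i).2.
  by rewrite (big_morph snd (id1 := 0) (op1 := +%R)).
have n1 (y : R^o * R^o) : `|y.1 : R| <= `|y| by rewrite prod_normE le_max lexx.
have n2 (y : R^o * R^o) : `|y.2 : R| <= `|y|.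
  by rewrite prod_normE le_max lexx orbT.
have bilin (a b x y N : R) : `|x| <= N -> `|y| <= N ->
    `|a * x + b * y| <= (`|a| + `|b|) * N.
  move=> xN yN; apply: (le_trans (ler_normD _ _)).
  by rewrite !normrM mulrDl lerD // ler_wpM2l.
have [/existsP[i /existsP[j dij]]|] :=
    boolP [exists i, exists j, det2 (v i) (v j) != 0].
  set d := det2 _ _ in dij.
  pose N := (`|(v j).2 : R| + `|(v j).1 : R|
    + (`|(v i).2 : R| + `|(v i).1 : R|)) / `|d|.
  have d0 : 0 < `|d| by rewrite normr_gt0.
  (* Each coefficient of the witness is a sum of two terms, each bounded by [N] times the norm of
     the vector. *)
  exists (N + N) => c.
  set y := \sum_i _.
  (* Cramer's rule for [y = a *: v i + b *: v j]. *)
  pose a : R := ((v j).2 * y.1 + - (v j).1 * y.2) / d.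
  pose b : R := (- (v i).2 * y.1 + (v i).1 * y.2) / d.
  have aN : `|a| <= N * `|y|.
    rewrite /a normrM normfV /N mulrAC ler_pM2r ?invr_gt0 //.
    apply: (le_trans (bilin _ _ _ _ _ (n1 y) (n2 y))).
    by rewrite normrN ler_wpM2r // lerDl addr_ge0.
  have bN : `|b| <= N * `|y|.
    rewrite /b normrM normfV /N mulrAC ler_pM2r ?invr_gt0 //.
    apply: (le_trans (bilin _ _ _ _ _ (n1 y) (n2 y))).
    by rewrite normrN ler_wpM2r // lerDr addr_ge0.
  exists (fun k => a *+ (k == i) + b *+ (k == j)).
    under eq_bigr do rewrite scalerDl.
    have pick (x : R) k0 : \sum_k (x *+ (k == k0)) *: v k = x *: v k0.
      rewrite (bigD1 k0) //= eqxx big1 ?addr0 // => k /negPf ->.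
      by rewrite scale0r.
    rewrite big_split /= !pick.
    have ed : (v i).1 * (v j).2 - (v i).2 * (v j).1 != 0 :> R by exact: dij.
    rewrite [LHS]surjective_pairing; congr (_, _);
      rewrite /= /a /b /d /det2 /GRing.scale /=; by field.
  move=> k; apply: (le_trans (ler_normD _ _)); rewrite mulrDl lerD //.
    by case: (k == i); rewrite ?mulr1n ?mulr0n ?normr0 ?(le_trans _ aN).
  by case: (k == j); rewrite ?mulr1n ?mulr0n ?normr0 ?(le_trans _ bN).
move=> /existsPn par.
have {}par i j : det2 (v i) (v j) = 0.
  by have /existsPn/(_ j)/negPn/eqP := par i.
have [/existsP[i vi]|/existsPn v0] := boolP [exists i, v i != 0].
  pose N : R := (v i).1 ^+ 2 + (v i).2 ^+ 2.
  have N0 : 0 < N.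
    rewrite lt_neqAle addr_ge0 ?sqr_ge0 // andbT eq_sym paddr_eq0 ?sqr_ge0 //.
    rewrite !sqrf_eq0; apply: contra vi => /andP[/eqP e1 /eqP e2].
    by rewrite [v i]surjective_pairing e1 e2.
  exists ((`|(v i).1 : R| + `|(v i).2 : R|) / N) => c.
  set y := \sum_i _.
  (* Since [y] is parallel to [v i], its projection onto the line of [v i] is [y] itself; both
     coordinate identities below differ from 0 by a multiple of this one. *)
  have yi : y.1 * (v i).2 - y.2 * (v i).1 = 0.
    rewrite sum1 sum2 !mulr_suml -sumrB big1 // => k _.
    by rewrite -!mulrA -mulrBr [X in _ * X](par k i) mulr0.
  pose a : R := ((v i).1 * y.1 + (v i).2 * y.2) / N.
  exists (fun k => a *+ (k == i)).
    rewrite (bigD1 i) //= eqxx big1 ?addr0 => [|k /negPf ->]; last first.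
      by rewrite scale0r.
    rewrite [LHS]surjective_pairing; congr (_, _);
      rewrite /= /a mulr1n /GRing.scale /=;
      apply: (mulIf (lt0r_neq0 N0)); rewrite mulrAC divfK ?lt0r_neq0 // /N.
      apply/eqP; rewrite -subr_eq0; apply/eqP.
      transitivity ((v i).2 * (y.1 * (v i).2 - y.2 * (v i).1)); first by ring.
      by rewrite yi mulr0.
    apply/eqP; rewrite -subr_eq0; apply/eqP.
    transitivity (- (v i).1 * (y.1 * (v i).2 - y.2 * (v i).1)); first by ring.
    by rewrite yi mulr0.
  have aN : `|a| <= (`|(v i).1 : R| + `|(v i).2 : R|) / N * `|y|.
    rewrite /a normrM normfV (gtr0_norm N0) mulrAC ler_pM2r ?invr_gt0 //.
    exact: bilin.
  move=> k; case: (k == i); rewrite ?mulr1n ?mulr0n ?normr0 //.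
  exact: le_trans aN.
exists 0 => c; exists (fun=> 0) => [|i]; last by rewrite normr0 mul0r.
by apply: eq_bigr => i _; rewrite (eqP (negPn (v0 i))) !scaler0.
Qed.

(** * Equalizing two products of positive weights *)

Section BalancedRelation.
Variables (R : rcfType) (m n : nat).
Hypothesis ltnm : (n < m)%N.

(** More rows than columns force a nonzero left kernel; a sign change, if needed, provides the
    negative entry. *)
Lemma exists_linear_relation (A : 'M[R]_(m, n)) :
  exists2 c : 'rV[R]_m, c *m A = 0 & exists i, c 0 i < 0.
Proof.
pose c := nz_row (kermx A).
have cA : c *m A = 0 by apply/sub_kermxP; apply: nz_row_sub.
have : c != 0.
  rewrite nz_row_eq0 -mxrank_eq0 mxrank_ker -lt0n subn_gt0.
  exact: leq_ltn_trans (rank_leq_col A) ltnm.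
case/rV0Pn=> i ci; case: (ltrgt0P (c 0 i)) ci => // ci _.
  by exists (- c); rewrite ?mulNmx ?cA ?oppr0 //; exists i; rewrite mxE oppr_lt0.
by exists c => //; exists i.
Qed.

(* Move [a] along a linear relation between the rows of [A] until a weight
   vanishes; the product then passes through [K]. *)
Lemma decrease_product (A : 'M[R]_(m, n)) (a : 'rV[R]_m) (K : R) :
  (forall i, 0 < a 0 i) -> 0 < K -> K <= \prod_i a 0 i ->
  exists b : 'rV[R]_m,
    [/\ forall i, 0 < b 0 i, b *m A = a *m A & \prod_i b 0 i = K].
Proof.
move=> a0 K0 Ka; have [c cA [i0 ci0]] := exists_linear_relation A.
(* For [c 0 i < 0], the time at which weight [i] of [a + t *: c] vanishes; [i1] is the first to do
   so. *)
pose r i := a 0 i / - c 0 i.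
have [i1 ci1 r1] : exists2 i1, c 0 i1 < 0 &
    forall j, c 0 j < 0 -> r i1 <= r j.
  case: (@Order.TotalTheory.arg_minP _ R _ i0 (fun i => c 0 i < 0) r) => // i ci ri.
  by exists i.
(* As a polynomial in the time, the gap between [K] and the product has a root by the intermediate
   value theorem of real closed fields. *)
pose p := K%:P - \prod_i ((a 0 i)%:P + c 0 i *: 'X).
have pE t : p.[t] = K - \prod_i (a 0 i + c 0 i * t).
  rewrite /p hornerD hornerN hornerC horner_prod.
  by congr (_ - _); apply: eq_bigr => i _; rewrite !hornerE.
have r10 : 0 < r i1 by rewrite divr_gt0 // oppr_gt0.
have pr1 : p.[r i1] = K.
  rewrite pE (bigD1 i1) //= /r.
  suff -> : a 0 i1 + c 0 i1 * (a 0 i1 / - c 0 i1) = 0 by rewrite mul0r subr0.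
  by field; rewrite ?oppr_eq0 ?lt_eqF.
have p0 : p.[0] <= 0.
  by rewrite pE; under eq_bigr do rewrite mulr0 addr0; rewrite subr_le0.
have [t /andP[t0 tr] /eqP pt] := @poly_ivt _ p 0 (r i1) (ltW r10)
  (introT andP (conj p0 (eq_ind_r (fun x => 0 <= x) (ltW K0) pr1))).
(* The root lies strictly before the first vanishing time, where [p] equals [K > 0], so all weights
   are still positive. *)
have {}tr : t < r i1.
  by rewrite lt_neqAle tr andbT; apply: contraTneq K0 => tE; rewrite -pr1 -tE pt ltxx.
exists (a + t *: c); split=> [i||].
- rewrite !mxE; have [ci|ci] := ltP (c 0 i) 0; last first.
    by rewrite ltr_wpDr // mulr_ge0.
  have : t < r i by apply: lt_le_trans tr (r1 _ ci).
  by rewrite /r ltr_pdivlMr ?oppr_gt0 // mulrN -subr_gt0 opprK.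
- by rewrite mulmxDl -scalemxAl cA scaler0 addr0.
- move: pt; rewrite pE => /eqP; rewrite subr_eq0 => /eqP ->.
  by apply: eq_bigr => i _; rewrite !mxE mulrC.
Qed.

Lemma balanced_relation (A B : 'M[R]_(m, n)) (a b : 'rV[R]_m) :
  (forall i, 0 < a 0 i) -> (forall i, 0 < b 0 i) ->
  exists a' b' : 'rV[R]_m,
    [/\ forall i, 0 < a' 0 i, forall i, 0 < b' 0 i,
        a' *m A + b' *m B = a *m A + b *m B &
        \prod_i a' 0 i = \prod_i b' 0 i].
Proof.
move=> a0 b0.
have [ba|/ltW ab] := leP (\prod_i b 0 i) (\prod_i a 0 i).
  have [|a' [a'0 a'A a'b]] := decrease_product A a0 _ ba.
    exact: prodr_gt0.
  by exists a', b; split=> //; rewrite a'A.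
have [|b' [b'0 b'B b'a]] := decrease_product B b0 _ ab.
  exact: prodr_gt0.
by exists a, b'; split=> //; rewrite b'B.
Qed.

End BalancedRelation.

(** * Determinants and positive rescalings of phase matrices *)

Lemma det_mx33 (R : comRingType) (M : 'M[R]_3) :
  \det M = M 0 0 * M 1 1 * M 2 2 + M 0 1 * M 1 2 * M 2 0
    + M 0 2 * M 1 0 * M 2 1 - M 0 0 * M 1 2 * M 2 1
    - M 0 1 * M 1 0 * M 2 2 - M 0 2 * M 1 1 * M 2 0.
Proof.
rewrite (expand_det_row _ 0) !big_ord_recl big_ord0 /cofactor.
rewrite !(expand_det_row _ 0) !big_ord_recl !big_ord0 /cofactor !det_mx11 !mxE.
(* With natural number indices, the lifted ordinals of the cofactor expansions compute to numerals,
   so [ring] recognizes equal entries. *)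
pose f (i j : nat) := M (inord i) (inord j).
have fE i j : M i j = f i j by rewrite /f !inord_val.
rewrite !fE /= /bump /=; ring.
Qed.

Section PhaseMatrix.
Variable R : realType.
Implicit Types Theta M : 'M[R[i]]_3.

Lemma phase_rank_ltn3 Theta (hTheta : is_phase_mx Theta) :
  (phase_rank hTheta < 3)%N <-> exists2 M, has_phase Theta M & \det M = 0.
Proof.
have rk (M : 'M[R[i]]_3) : (\rank M < 3)%N = (\det M == 0).
  rewrite ltn_neqAle rank_leq_row andbT -/(row_free M) row_free_unit.
  by rewrite unitmxE unitfE negbK.
rewrite /phase_rank; case: ex_minnP => r /asboolP[M hM <-] rmin.
split=> [|[N hN N0]]; first by rewrite rk => /eqP; exists M.
rewrite (leq_ltn_trans (rmin (\rank N) _)) ?rk ?N0 //.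
by apply/asboolP; exists N.
Qed.

(** The matrix [A] consists of the moduli of the entries of [M], read as real parts because the norm
    of [R[i]] takes its values in [R[i]]. *)
Lemma has_phaseP Theta (hTheta : is_phase_mx Theta) M :
  has_phase Theta M <->
  exists2 A : 'M[R]_3, forall i j, 0 < A i j &
    M = \matrix_(i, j) ((A i j)%:C%C * Theta i j).
Proof.
split=> [hM|[A A0 ->] i j].
  have nE (z : R[i]) : `|z| = (complex.Re `|z|)%:C%C by rewrite normc_def.
  exists (\matrix_(i, j) complex.Re `|M i j|) => [i j|].
    rewrite mxE; have := hM i j => -[].
    by rewrite -normr_gt0 nE ltcR.
  apply/matrixP => i j; rewrite !mxE -nE; have [M0 <-] := hM i j.
  by rewrite mulrC divfK // normr_eq0.
rewrite !mxE normrM hTheta mulr1 ger0_norm ?lecR ?ltW //.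
have A'0 : (A i j)%:C%C != 0 :> R[i] by rewrite gt_eqF // ltcR.
split; last by rewrite mulrAC divff // mul1r.
by rewrite mulf_neq0 // -normr_eq0 hTheta oner_eq0.
Qed.

Lemma plane_relationE (l : 'I_6 -> R) (z : 6.-tuple R[i]) :
  \sum_i l i *: complex_to_plane (tnth z i) = 0 <->
  \sum_i (l i)%:C%C * tnth z i = 0.
Proof.
have -> : \sum_i l i *: complex_to_plane (tnth z i) =
    complex_to_plane (\sum_i (l i)%:C%C * tnth z i).
  rewrite (big_morph (@complex_to_plane R) (id1 := 0) (op1 := +%R)) //.
    apply: eq_bigr => i _; case: (tnth z i) => x y.
    by rewrite /complex_to_plane /= !mul0r subr0 addr0.
  by move=> [a b] [c d].
case: (\sum_i _) => x y; rewrite /complex_to_plane /=.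
by split=> [[-> ->]|[-> ->]].
Qed.

End PhaseMatrix.

(** * Realizing weights as the monomials of a positive matrix *)

Section DetVector.
Variable R : realType.
Implicit Types Theta : 'M[R[i]]_3.

(** Turns three complex numbers into the rows of a matrix with two columns, the form that
    [balanced_relation] expects. *)
Definition re_im (z : R[i]) : 'rV[R]_2 :=
  \row_j (if j == 0 then complex.Re z else complex.Im z).

Lemma re_imD : {morph re_im : x y / x + y}.
Proof. by move=> [a b] [c d]; apply/rowP => j; rewrite !mxE /=; case: ifP. Qed.

Lemma re_im_eq0 z : re_im z = 0 <-> z = 0.
Proof.
case: z => x y; split=> [/rowP e|[-> ->]].
  by have := e 0; have := e 1; rewrite !mxE /= => -> ->.
by apply/rowP => j; rewrite !mxE /=; case: ifP.
Qed.

Lemma mulmx_re_im m (a : 'rV[R]_m) (z : 'I_m -> R[i]) :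
  a *m (\matrix_i re_im (z i)) = re_im (\sum_i (a 0 i)%:C%C * z i).
Proof.
rewrite mulmx_sum_row (big_morph re_im (id1 := 0) (op1 := +%R) re_imD).
  apply: eq_bigr => i _; rewrite rowK; case: (z i) => x y.
  apply/rowP => j; rewrite !mxE /=; case: ifP => _; rewrite ?mul0r ?subr0 ?addr0 //.
by apply/re_im_eq0.
Qed.

(** The signs of the permutations are carried by [det_vector], so the weights are plain products of
    entries of [A], positive whenever [A] is. *)
Lemma det_scaled_phase (A : 'M[R]_3) Theta :
  \det (\matrix_(i, j) ((A i j)%:C%C * Theta i j)) =
  \sum_i (tnth [tuple A 0 0 * A 1 1 * A 2 2; A 0 1 * A 1 2 * A 2 0;
                      A 0 2 * A 1 0 * A 2 1; A 0 0 * A 1 2 * A 2 1;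
                      A 0 1 * A 1 0 * A 2 2; A 0 2 * A 1 1 * A 2 0] i)%:C%C
          * tnth (det_vector Theta) i.
Proof.
rewrite det_mx33 !mxE !big_ord_recl big_ord0 !(tnth_nth 0) /=.
by rewrite !rmorphM /=; ring.
Qed.

Lemma scaled_phase_det0P Theta :
  (exists2 A : 'M[R]_3, forall i j, 0 < A i j &
     \det (\matrix_(i, j) ((A i j)%:C%C * Theta i j)) = 0) <->
  (exists2 l : 'I_6 -> R, forall i, 0 < l i &
     \sum_i (l i)%:C%C * tnth (det_vector Theta) i = 0).
Proof.
split=> [[A A0]|[l l0 lz]].
  rewrite det_scaled_phase => dA; eexists; last exact: dA.
  move=> i; rewrite (tnth_nth 0).
  by case: i => [[|[|[|[|[|[|i]]]]]] //= _]; rewrite !mulr_gt0.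
set d := tnth (det_vector Theta) in lz.
(* The first three entries of [det_vector] belong to the even permutations, the last three to the
   odd ones. *)
pose P : 'M[R]_(3, 2) := \matrix_i re_im (d (@lshift 3 3 i)).
pose N : 'M[R]_(3, 2) := \matrix_i re_im (d (@rshift 3 3 i)).
pose a := \row_i l (@lshift 3 3 i).
pose b := \row_i l (@rshift 3 3 i).
have ab0 : a *m P + b *m N = 0.
  rewrite !mulmx_re_im -re_imD; apply/re_im_eq0.
  transitivity (\sum_(i < 3 + 3) (l i)%:C%C * d i); last exact: lz.
  by rewrite big_split_ord /=; congr (_ + _); apply: eq_bigr => i _; rewrite mxE.
have [|||a' [b' [a'0 b'0]]] := @balanced_relation R 3 2 _ P N a b => //.
- by move=> i; rewrite mxE.
- by move=> i; rewrite mxE.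
rewrite {}ab0 !mulmx_re_im -re_imD => /re_im_eq0.
pose p (i : nat) := a' 0 (inord i); pose n (i : nat) := b' 0 (inord i).
have pE i : a' 0 i = p i by rewrite /p inord_val.
have nE i : b' 0 i = n i by rewrite /n inord_val.
have p0 i : 0 < p i by exact: a'0.
have n0 i : 0 < n i by exact: b'0.
rewrite !big_ord_recl !big_ord0 !pE !nE /= /bump /= !mulr1 !addr0 !addn0.
rewrite add1n => rel pn.
have e0 : p 0%N / n 1%N * n 1%N = p 0%N by rewrite divfK // gt_eqF.
have e1 : n 0%N / p 2%N * (p 1%N * p 2%N / n 0%N) = p 1%N.
  by field; rewrite !gt_eqF.
have e3 : n 0%N / p 2%N * p 2%N = n 0%N by rewrite divfK // gt_eqF.
have e5 : p 0%N / n 1%N * (p 1%N * p 2%N / n 0%N) = n 2%N.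
  transitivity (p 0%N * (p 1%N * p 2%N) / (n 0%N * n 1%N)).
    by field; rewrite !gt_eqF.
  by rewrite pn; field; rewrite !gt_eqF.
(* With the first row and the entry [(1, 0)] set to 1, five of the six monomial equations determine
   the other entries one after another. The sixth, [e5], is the equality of products [pn]. *)
exists (\matrix_(i, j) nth 0 (nth [::] [:: [:: 1; 1; 1];
    [:: 1; p 0%N / n 1%N; n 0%N / p 2%N];
    [:: p 1%N * p 2%N / n 0%N; p 2%N; n 1%N]] i) j).
  move=> i j; rewrite mxE.
  case: i => [[|[|[|i]]] //= _]; case: j => [[|[|[|j]]] //= _];
    by rewrite ?ltr01 ?divr_gt0 ?mulr_gt0.
rewrite det_scaled_phase; apply: etrans rel.
rewrite /d !big_ord_recl !big_ord0 !(tnth_nth 0) !mxE /= /bump /=.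
by rewrite !mul1r e0 e1 e3 e5 addr0 !addrA.
Qed.

End DetVector.

Theorem theorem4p3 (R : realType) (Theta : 'M[R[i]]_3)
    (hTheta : is_phase_mx Theta) :
  (phase_rank hTheta < 3)%N <->
  relative_interior
    (convex_hull (@complex_to_plane R @` [set` det_vector Theta])) 0.
Proof.
set d := det_vector Theta.
(* An indexed family gives each permutation its own weight, even when entries of [d] coincide. *)
have -> : @complex_to_plane R @` [set` d] =
    range (fun i => complex_to_plane (tnth d i)).
  apply/seteqP; split=> _ [z zd <-].
    by have /tnthP[i ->] : z \in d by []; exists i.
  by exists (tnth d z) => //=; apply: mem_tnth.
have [C HC] := plane_bounded_coords (fun i => complex_to_plane (tnth d i)).
split=> [/phase_rank_ltn3[M /(has_phaseP hTheta)[A A0 ->] dA]|relint].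
  have [|l l0 lz] := (scaled_phase_det0P Theta).1; first by exists A.
  apply: (relint0_of_positive_relation ord0 HC l0).
  by apply/plane_relationE.
have [l l0 /plane_relationE lz] := relint0_positive_relation relint.
have [|A A0 dA] := (scaled_phase_det0P Theta).2; first by exists l.
apply/phase_rank_ltn3; exists (\matrix_(i, j) ((A i j)%:C%C * Theta i j)) => //.
by apply/(has_phaseP hTheta); exists A.
Qed.
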